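(* Let $p$ be a prime. For any $p$-adic Möbius map $g\in\mathrm{PSL}(2,\mathbb{C}_p)$, we have $$2^{-1}\varepsilon(g)\le M(g)\le 6\,\varepsilon(g),$$ where $\varepsilon(g)=\max\{\rho_v(g(z_0),z_0),\rho_v(g(z_1),z_1),\rho_v(g(z_2),z_2)\}$ and $z_0,z_1,z_2$ are the three distinct roots in $\mathbb{C}_p$ of the equation $z^3=1$.
   Context: $\mathbb{C}_p$ is the completion of the algebraic closure of $\mathbb{Q}_p$, with $|p|=p^{-1}$. A $p$-adic Möbius map is an element of $\mathrm{PSL}(2,\mathbb{C}_p)=\mathrm{SL}(2,\mathbb{C}_p)/\{\pm I\}$, acting on $\mathbb{P}^1(\mathbb{C}_p)=\mathbb{C}_p\cup\{\infty\}$ by $z\mapsto\frac{az+b}{cz+d}$, $ad-bc=1$. Chordal metric: $\rho_v(z,w)=\frac{|z-w|}{\max\{1,|z|\}\max\{1,|w|\}}$ for $z,w\in\mathbb{C}_p$, $\rho_v(\infty,w)=\rho_v(w,\infty)=\frac1{\max\{1,|w|\}}$ for $w\in\mathbb{C}_p$, $\rho_v(\infty,\infty)=0$. Matrix norm: $\|(a_{ij})\|=\max_{i,j}|a_{ij}|$; $\|g\|$ is the norm of either lift of $g$ to $\mathrm{SL}(2,\mathbb{C}_p)$. Define $M(g)=\|g-g^{-1}\|/\|g\|$, where $g-g^{-1}$ is the difference of a lift of $g$ and the inverse matrix of that same lift; i.e. for $g(z)=\frac{az+b}{cz+d}$ with $ad-bc=1$, $M(g)=\frac{\max\{|a-d|,|2b|,|2c|\}}{\max\{|a|,|b|,|c|,|d|\}}$.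 *)

(* Defs.v *)
From HB Require Import structures.
From mathcomp Require Import all_boot all_order all_algebra.
From mathcomp Require Import generic_quotient.
From mathcomp Require Import reals.

Set Implicit Arguments.
Unset Strict Implicit.
Unset Printing Implicit Defensive.

Import Order.TTheory GRing.Theory Num.Theory.
Local Open Scope ring_scope.
Local Open Scope quotient_scope.

Definition padic_abs (R : realType) (p : nat) (x : rat) : R :=
  if x == 0 then 0
  else p%:R ^ ((logn p `|denq x|)%:Z - (logn p `|numq x|)%:Z).

Definition nonarch_abs (R : realType) (K : fieldType) (v : K -> R) : Prop :=
  [/\ forall x, 0 <= v x,
      forall x, v x = 0 <-> x = 0,
      forall x y, v (x * y) = v x * v y
    & forall x y, v (x + y) <= Num.max (v x) (v y)].

Definition cauchy_seq (R : realType) (K : fieldType) (v : K -> R)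
    (u : nat -> K) : Prop :=
  forall e : R, 0 < e ->
    exists N : nat, forall m n, (N <= m)%N -> (N <= n)%N -> v (u m - u n) < e.

Definition converges_to (R : realType) (K : fieldType) (v : K -> R)
    (u : nat -> K) (l : K) : Prop :=
  forall e : R, 0 < e ->
    exists N : nat, forall n, (N <= n)%N -> v (u n - l) < e.

Definition abs_complete (R : realType) (K : fieldType) (v : K -> R) : Prop :=
  forall u, cauchy_seq v u -> exists l, converges_to v u l.

Definition is_completion (R : realType) (K L : fieldType)
    (vK : K -> R) (vL : L -> R) (i : {rmorphism K -> L}) : Prop :=
  [/\ nonarch_abs vL,
      forall x, vL (i x) = vK x,
      forall y (e : R), 0 < e -> exists x, vL (y - i x) < e
    & abs_complete vL].

Definition is_algebraic_closure (K L : fieldType) (i : {rmorphism K -> L}) :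
    Prop :=
  GRing.closed_field_axiom L /\ forall y : L, algebraicOver i y.

(* Each field below is determined by the previous one up to isometric
   isomorphism (the absolute value of [Qp] has a unique extension to [Qpbar]),
   so an inhabitant is C_p itself, presented by its construction
   Q -> Q_p -> algebraic closure of Q_p -> C_p. *)
Record Cp_field (R : realType) (p : nat) := CpField {
  Qp : fieldType;
  Qp_abs : Qp -> R;
  Qp_inj : {rmorphism rat -> Qp};
  Qp_completion : is_completion (@padic_abs R p) Qp_abs Qp_inj;
  Qpbar : fieldType;
  Qpbar_abs : Qpbar -> R;
  Qpbar_inj : {rmorphism Qp -> Qpbar};
  Qpbar_closure : is_algebraic_closure Qpbar_inj;
  Qpbar_nonarch : nonarch_abs Qpbar_abs;
  Qpbar_abs_ext : forall x, Qpbar_abs (Qpbar_inj x) = Qp_abs x;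
  Cp :> fieldType;
  Cp_abs : Cp -> R;
  Cp_inj : {rmorphism Qpbar -> Cp};
  Cp_completion : is_completion Qpbar_abs Cp_abs Cp_inj
}.

Arguments Cp_abs {R p} c x.

Definition SL2 (K : fieldType) := {A : 'M[K]_2 | \det A == 1}.

Definition pm_eq (K : fieldType) (A B : SL2 K) : bool :=
  (val A == val B) || (val A == - val B).

Lemma pm_eq_refl (K : fieldType) : reflexive (@pm_eq K).
Proof. by move=> A; rewrite /pm_eq eqxx. Qed.

Lemma pm_eq_sym (K : fieldType) : symmetric (@pm_eq K).
Proof.
by move=> A B; rewrite /pm_eq eq_sym [val B == - _]eq_sym eqr_oppLR.
Qed.

Lemma pm_eq_trans (K : fieldType) : transitive (@pm_eq K).
Proof.
move=> B A C; rewrite /pm_eq => /orP[]/eqP-> /orP[]/eqP->;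
  by rewrite ?opprK ?eqxx ?orbT.
Qed.

Canonical pm_equiv (K : fieldType) :=
  EquivRel (@pm_eq K) (@pm_eq_refl K) (@pm_eq_sym K) (@pm_eq_trans K).

Definition PSL2 (K : fieldType) : Type := {eq_quot (pm_equiv K)}.

Definition class_of (K : fieldType) (A : SL2 K) : PSL2 K :=
  \pi_{eq_quot (pm_equiv K)} A.

(* [lift g] is one of the two matrices representing [g]; the lemmas
   [moebius_lift] and [displacement_lift] show that the choice is immaterial. *)
Definition lift (K : fieldType) (g : PSL2 K) : 'M[K]_2 :=
  val (repr (g : {eq_quot (pm_equiv K)})).

Lemma lift_class_of (K : fieldType) (A : SL2 K) :
  lift (class_of A) = val A \/ lift (class_of A) = - val A.
Proof.
have : repr (class_of A : {eq_quot (pm_equiv K)}) == A %[mod {eq_quot (pm_equiv K)}].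
  by rewrite reprK.
by rewrite eqmodE => /orP[]/eqP; [left | right].
Qed.

(* The projective line, with [None] the point at infinity. *)
Definition P1 (K : fieldType) : Type := option K.

Definition moebius_mx (K : fieldType) (A : 'M[K]_2) (z : P1 K) : P1 K :=
  let a := A 0 0 in let b := A 0 1 in let c := A 1 0 in let d := A 1 1 in
  match z with
  | Some x =>
      if c * x + d == 0 then None else Some ((a * x + b) / (c * x + d))
  | None => if c == 0 then None else Some (a / c)
  end.

Definition moebius (K : fieldType) (g : PSL2 K) (z : P1 K) : P1 K :=
  moebius_mx (lift g) z.

Definition chordal (R : realType) (K : fieldType) (v : K -> R)
    (z w : P1 K) : R :=
  match z, w with
  | Some x, Some y => v (x - y) / (Num.max 1 (v x) * Num.max 1 (v y))
  | None, Some y => 1 / Num.max 1 (v y)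
  | Some x, None => 1 / Num.max 1 (v x)
  | None, None => 0
  end.

Definition mx_norm2 (R : realType) (K : fieldType) (v : K -> R)
    (A : 'M[K]_2) : R :=
  \big[Num.max/0]_(i < 2) \big[Num.max/0]_(j < 2) v (A i j).

Definition displacement_mx (R : realType) (K : fieldType) (v : K -> R)
    (A : 'M[K]_2) : R :=
  mx_norm2 v (A - invmx A) / mx_norm2 v A.

(* M(g) *)
Definition displacement (R : realType) (K : fieldType) (v : K -> R)
    (g : PSL2 K) : R :=
  displacement_mx v (lift g).

(* epsilon(g) *)
Definition max_move (R : realType) (K : fieldType) (v : K -> R)
    (g : PSL2 K) (z0 z1 z2 : K) : R :=
  let move z := chordal v (moebius g (Some z)) (Some z) in
  Num.max (Num.max (move z0) (move z1)) (move z2).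

Lemma nonarch_absN (R : realType) (K : fieldType) (v : K -> R) :
  nonarch_abs v -> forall x, v (- x) = v x.
Proof.
move=> [v0 vE vM _] x.
suff vN1 : v (- 1) = 1 by rewrite -mulN1r vM vN1 mul1r.
have v1 : v 1 = 1.
  have v1n0 : v 1 != 0 by apply/eqP => /vE /eqP; rewrite oner_eq0.
  by apply: (mulfI v1n0); rewrite -vM !mulr1.
apply/eqP; rewrite -(@eqrXn2 _ 2) ?v0 ?ler01 //.
by rewrite expr2 -vM mulrNN mulr1 v1 expr1n.
Qed.

Lemma moebius_lift (K : fieldType) (A : SL2 K) (z : P1 K) :
  moebius (class_of A) z = moebius_mx (val A) z.
Proof.
rewrite /moebius; case: (lift_class_of A) => -> //.
rewrite /moebius_mx; case: z => [x|]; rewrite !mxE.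
  by rewrite !mulNr -!opprD oppr_eq0 invrN mulrNN.
by rewrite oppr_eq0 invrN mulrNN.
Qed.

Lemma displacement_lift (R : realType) (K : fieldType) (v : K -> R)
    (A : SL2 K) :
  nonarch_abs v -> displacement v (class_of A) = displacement_mx v (val A).
Proof.
move=> hv; rewrite /displacement; case: (lift_class_of A) => -> //.
have mxN B : mx_norm2 v (- B) = mx_norm2 v B.
  by apply: eq_bigr => i _; apply: eq_bigr => j _; rewrite mxE nonarch_absN.
have invN : invmx (- val A) = - invmx (val A).
  exact: invrN (val A : 'M[K]_2).
by rewrite /displacement_mx invN -opprD !mxN.
Qed.

(* Main.v *)
Require Import Defs.
From HB Require Import structures.
From mathcomp Require Import all_boot all_order all_algebra.
From mathcomp Require Import reals.
From mathcomp Require Import ring lra.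

Import Order.TTheory GRing.Theory Num.Theory.
Local Open Scope ring_scope.

(** Write [A] for a lift of [g], with entries [a], [b], [c], [d], write [N] for
    its norm and [P] for the norm of [A - A^-1], which is the maximum of
    [|a - d|], [|2b|], [|2c|].  The fixed points of [g] are the roots of the
    quadratic form [q(z) = c z^2 + (d - a) z - b], and a point with [|z| = 1]
    is moved by [g] through the chordal distance [|q(z)| / D(z)], where
    [D(z) = max(|a z + b|, |c z + d|)] ([chordal_moebius_mx]).

    Upper bound.  As [D(z) <= N], every cube root of unity satisfies
    [|q(z)| <= N * eps].  Averaging [z^k q(z)] over the cube roots of unity
    recovers the coefficients of [q] up to a factor 3, and [|3| >= 1/3]
    ([fixed_form_interpolation]), so [P <= 3 N eps].

    Lower bound.  If [N <= 1], then [A] is integral of determinant 1, so it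
    preserves the sup norm on the plane and [D(z) >= 1]; the distance is then at
    most the largest coefficient of [q], hence at most [2 P] because
    [|2| >= 1/2].  If [N > 1], the relation [a d - b c = 1] forces [N <= 2 P]
    ([mx_norm2_le_displacement]), and chordal distances never exceed 1.

    The bounds on [|2|] and [|3|] come from [p ^ v_p(n) <= n]; they are the only
    place where the residue characteristic enters. *)

(** * Ultrametric estimates *)

Section Nonarchimedean.
Set Implicit Arguments.
Unset Strict Implicit.
Unset Printing Implicit Defensive.
Context {R : realType} {K : fieldType} {v : K -> R}.
Hypothesis v_na : nonarch_abs v.

Lemma nonarch_abs_ge0 x : 0 <= v x.
Proof. by case: v_na. Qed.

Lemma nonarch_absM x y : v (x * y) = v x * v y.
Proof. by case: v_na. Qed.

Lemma nonarch_abs0 : v 0 = 0.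
Proof. by case: v_na => _ /(_ 0) [_ ->]. Qed.

Lemma nonarch_abs_gt0 x : x != 0 -> 0 < v x.
Proof.
move=> xn0; rewrite lt_def nonarch_abs_ge0 andbT.
by apply: contra xn0 => /eqP vx0; case: v_na => _ /(_ x) [/(_ vx0) ->].
Qed.

Lemma nonarch_abs1 : v 1 = 1.
Proof.
have v1n0 : v 1 != 0 by rewrite gt_eqF // nonarch_abs_gt0 // oner_eq0.
by apply: (mulfI v1n0); rewrite -nonarch_absM !mulr1.
Qed.

Lemma nonarch_absD_le x y m : v x <= m -> v y <= m -> v (x + y) <= m.
Proof.
move=> xm ym; case: v_na => _ _ _ /(_ x y) /le_trans; apply.
by rewrite ge_max xm ym.
Qed.

Lemma nonarch_absB_le x y m : v x <= m -> v y <= m -> v (x - y) <= m.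
Proof. by move=> xm ym; apply: nonarch_absD_le; rewrite ?nonarch_absN. Qed.

Lemma nonarch_absM_le x y m n : v x <= m -> v y <= n -> v (x * y) <= m * n.
Proof. by move=> xm yn; rewrite nonarch_absM ler_pM ?nonarch_abs_ge0. Qed.

Lemma nonarch_abs_nat_le1 n : v n%:R <= 1.
Proof.
elim: n => [|n IHn]; first by rewrite nonarch_abs0.
by rewrite -addn1 natrD nonarch_absD_le // nonarch_abs1.
Qed.

Lemma nonarch_abs_root_of_unity n x : x ^+ n.+1 = 1 -> v x = 1.
Proof.
move=> xn; apply/eqP; rewrite -(@pexpr_eq1 _ _ n.+1) ?nonarch_abs_ge0 //.
have vX m : v (x ^+ m) = v x ^+ m.
  by elim: m => [|m IHm]; rewrite ?nonarch_abs1 // !exprS nonarch_absM IHm.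
by rewrite -vX xn nonarch_abs1.
Qed.

(** * Norms of two-by-two matrices *)

Lemma entry_le_mx_norm2 (A : 'M[K]_2) i j : v (A i j) <= mx_norm2 v A.
Proof.
rewrite /mx_norm2; apply: (le_trans _ (le_bigmax _ _ i)).
exact: (le_bigmax _ (fun j => v (A i j)) j).
Qed.

Lemma mx_norm2_le (A : 'M[K]_2) m :
  v (A 0 0) <= m -> v (A 0 1) <= m -> v (A 1 0) <= m -> v (A 1 1) <= m ->
  mx_norm2 v A <= m.
Proof.
move=> h00 h01 h10 h11.
have m0 : 0 <= m := le_trans (nonarch_abs_ge0 _) h00.
have I2 (i : 'I_2) : i = 0 \/ i = 1.
  by case: i => [[|[|//]] lti]; [left | right]; apply: val_inj.
apply: bigmax_le => // i _; apply: bigmax_le => // j _.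
by case: (I2 i) => ->; case: (I2 j) => ->.
Qed.

Lemma lift_ord0 : fintype.lift (0 : 'I_2) (0 : 'I_1) = 1.
Proof. exact: val_inj. Qed.

Lemma lift_ord1 : fintype.lift (1 : 'I_2) (0 : 'I_1) = 0.
Proof. exact: val_inj. Qed.

Lemma det1_mx22 (A : 'M[K]_2) :
  \det A = 1 -> A 0 0 * A 1 1 - A 0 1 * A 1 0 = 1.
Proof.
rewrite (expand_det_row _ 0) !big_ord_recl big_ord0 /cofactor !det_mx11 !mxE /=.
rewrite lift_ord0 lift_ord1 => <-; ring.
Qed.

Lemma mx_norm2_ge1 (A : 'M[K]_2) : \det A = 1 -> 1 <= mx_norm2 v A.
Proof.
move=> /det1_mx22 detA; have N0 : 0 <= mx_norm2 v A.
  exact: le_trans (nonarch_abs_ge0 _) (entry_le_mx_norm2 A 0 0).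
rewrite -(@ler_pXn2r _ 2) ?nnegrE ?expr1n // -nonarch_abs1 -detA expr2.
by apply: nonarch_absB_le; apply: nonarch_absM_le; apply: entry_le_mx_norm2.
Qed.

Lemma sub_invmx22 (A : 'M[K]_2) : \det A = 1 ->
  [/\ (A - invmx A) 0 0 = A 0 0 - A 1 1, (A - invmx A) 0 1 = 2 * A 0 1,
      (A - invmx A) 1 0 = 2 * A 1 0 & (A - invmx A) 1 1 = A 1 1 - A 0 0].
Proof.
move=> detA.
have -> : invmx A = \adj A.
  by rewrite /invmx unitmxE detA unitr1 invr1 scale1r.
rewrite !mxE /cofactor !det_mx11 !mxE /=.
by rewrite ?lift_ord0 ?lift_ord1 /=; split; ring.
Qed.


(** A large matrix of determinant 1 cannot be close to its inverse: if [a - d]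
    and the off-diagonal entries were all small compared with [N > 1], then
    [a] and [d] would both have absolute value [N], and [a d] could not be
    cancelled by [b c] down to 1. *)
Lemma mx_norm2_le_displacement (A : 'M[K]_2) :
  2^-1 <= v 2 -> \det A = 1 -> 1 < mx_norm2 v A ->
  mx_norm2 v A <= 2 * mx_norm2 v (A - invmx A).
Proof.
move=> v2 detA N1; rewrite leNgt; apply/negP => P_small.
have [e00 e01 e10 e11] := sub_invmx22 detA.
have := entry_le_mx_norm2 (A - invmx A) 0 0; rewrite e00.
have := entry_le_mx_norm2 (A - invmx A) 0 1; rewrite e01 nonarch_absM.
have := entry_le_mx_norm2 (A - invmx A) 1 0; rewrite e10 nonarch_absM.
set N := mx_norm2 v A in N1 P_small *; set P := mx_norm2 _ _ in P_small *.
move=> hc hb had.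
have b0 := nonarch_abs_ge0 (A 0 1); have c0 := nonarch_abs_ge0 (A 1 0).
have ad0 := nonarch_abs_ge0 (A 0 0 - A 1 1).
have bP : v (A 0 1) <= 2 * P by nra.
have cP : v (A 1 0) <= 2 * P by nra.
have dN : 2 * P < v (A 1 1).
  rewrite ltNge; apply/negP => dP.
  suff: N <= 2 * P by rewrite leNgt P_small.
  apply: mx_norm2_le => //.
  by rewrite -(subrK (A 1 1) (A 0 0)) nonarch_absD_le //; lra.
have aN : 2 * P < v (A 0 0).
  rewrite ltNge; apply/negP => aP; move: dN; rewrite ltNge => /negP; apply.
  by rewrite -(subKr (A 0 0) (A 1 1)) nonarch_absB_le //; lra.
have da : v (A 1 1) <= v (A 0 0).
  by rewrite -(subKr (A 0 0) (A 1 1)) nonarch_absB_le //; lra.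
have ad : v (A 0 0) <= v (A 1 1).
  by rewrite -[X in v X <= _](subrK (A 1 1)) nonarch_absD_le //; lra.
have NaE : N <= v (A 0 0) by apply: mx_norm2_le => //; lra.
have : v (A 0 0 * A 1 1) <= Num.max 1 (2 * P * (2 * P)).
  rewrite -[A 0 0 * _](subrK (A 0 1 * A 1 0)) (det1_mx22 detA).
  apply: nonarch_absD_le; first by rewrite nonarch_abs1 le_max lexx.
  by rewrite le_max nonarch_absM_le ?orbT.
rewrite nonarch_absM le_max => /orP[]; nra.
Qed.

(** * The displacement of a point of absolute value one *)

(** The fixed points of [A] in the affine line are the zeros of this form. *)
Definition fixed_form (A : 'M[K]_2) (z : K) : K :=
  A 1 0 * z ^+ 2 + (A 1 1 - A 0 0) * z - A 0 1.

Definition image_height (A : 'M[K]_2) (z : K) : R :=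
  Num.max (v (A 0 0 * z + A 0 1)) (v (A 1 0 * z + A 1 1)).

Lemma fixed_formE (A : 'M[K]_2) z :
  fixed_form A z = z * (A 1 0 * z + A 1 1) - (A 0 0 * z + A 0 1).
Proof. by rewrite /fixed_form; ring. Qed.

Lemma fixed_form_le (A : 'M[K]_2) z : v z = 1 ->
  v (fixed_form A z) <= image_height A z.
Proof.
move=> z1; rewrite fixed_formE.
by apply: nonarch_absB_le; rewrite ?nonarch_absM ?z1 ?mul1r le_max lexx ?orbT.
Qed.

Lemma image_height_le (A : 'M[K]_2) z : v z = 1 ->
  image_height A z <= mx_norm2 v A.
Proof.
move=> z1; rewrite /image_height ge_max.
by rewrite !nonarch_absD_le ?nonarch_absM ?z1 ?mulr1 ?entry_le_mx_norm2.
Qed.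

(** The identity [a (c z + d) - c (a z + b) = 1] keeps the image of a vector
    [(z, 1)] away from the origin. *)
Lemma mx_norm2_image_height (A : 'M[K]_2) z : \det A = 1 ->
  1 <= mx_norm2 v A * image_height A z.
Proof.
move=> /det1_mx22 detA; rewrite -nonarch_abs1 -detA.
have -> : A 0 0 * A 1 1 - A 0 1 * A 1 0 =
    A 0 0 * (A 1 0 * z + A 1 1) - A 1 0 * (A 0 0 * z + A 0 1) by ring.
by apply: nonarch_absB_le; apply: nonarch_absM_le;
  rewrite ?entry_le_mx_norm2 // le_max lexx ?orbT.
Qed.

Lemma image_height_gt0 (A : 'M[K]_2) z : \det A = 1 -> 0 < image_height A z.
Proof.
move=> detA; rewrite -(@pmulr_rgt0 _ (mx_norm2 v A)).
  exact: lt_le_trans ltr01 (mx_norm2_image_height z detA).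
exact: lt_le_trans ltr01 (mx_norm2_ge1 detA).
Qed.

Lemma chordal_ge0 (z w : P1 K) : 0 <= chordal v z w.
Proof.
have max1_ge0 x : 0 <= Num.max 1 x :> R by rewrite le_max ler01.
by case: z w => [x|] [y|] //=;
  rewrite divr_ge0 ?mulr_ge0 ?max1_ge0 ?nonarch_abs_ge0.
Qed.

Lemma chordal_moebius_mx (A : 'M[K]_2) z : \det A = 1 -> v z = 1 ->
  chordal v (moebius_mx A (Some z)) (Some z) =
  v (fixed_form A z) / image_height A z.
Proof.
move=> detA z1; have := image_height_gt0 z detA.
rewrite /image_height fixed_formE /=.
set u := A 0 0 * z + A 0 1; set w := A 1 0 * z + A 1 1.
have [-> | wn0] /= := eqVneq w 0; rewrite z1 maxxx.
  (* the image is the point at infinity, at distance 1 *)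
  rewrite nonarch_abs0 mulr0 sub0r nonarch_absN // (max_l (nonarch_abs_ge0 u)).
  by move=> u0; rewrite divr1 divff // gt_eqF.
move=> _; have w0 := nonarch_abs_gt0 wn0.
have -> : z * w - u = - ((u / w - z) * w) by field.
have -> : Num.max (v u) (v w) = Num.max 1 (v (u / w)) * v w.
  rewrite maxr_pMl ?nonarch_abs_ge0 // mul1r -nonarch_absM divfK //.
  by rewrite maxC.
rewrite nonarch_absN // (nonarch_absM (u / w - z)) mulr1 -mulf_div divff ?mulr1 //.
by rewrite gt_eqF.
Qed.

Lemma chordal_moebius_mx_le (A : 'M[K]_2) z :
  2^-1 <= v 2 -> \det A = 1 -> v z = 1 ->
  2^-1 * chordal v (moebius_mx A (Some z)) (Some z) <= displacement_mx v A.
Proof.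
move=> v2 detA z1; rewrite chordal_moebius_mx // /displacement_mx.
have D0 := image_height_gt0 z detA; have N1 := mx_norm2_ge1 detA.
have N0 : 0 < mx_norm2 v A := lt_le_trans ltr01 N1.
rewrite ler_pdivlMr // mulrA mulrAC ler_pdivrMr //.
have qD := fixed_form_le A z1; have q0 := nonarch_abs_ge0 (fixed_form A z).
set P := mx_norm2 _ (A - _).
have [N_le1 | N_gt1] := lerP (mx_norm2 v A) 1; last first.
  have := ler_pM q0 (ltW N0) qD (mx_norm2_le_displacement v2 detA N_gt1).
  by rewrite -/P; nra.
have N_eq1 : mx_norm2 v A = 1 by apply: le_anti; rewrite N_le1 N1.
have := mx_norm2_image_height z detA; rewrite N_eq1 mul1r mulr1 => D1.
have [e00 e01 e10 e11] := sub_invmx22 detA.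
suff: v (fixed_form A z) <= 2 * P by nra.
have := entry_le_mx_norm2 (A - invmx A) 1 1; rewrite e11.
have := entry_le_mx_norm2 (A - invmx A) 0 1; rewrite e01 nonarch_absM.
have := entry_le_mx_norm2 (A - invmx A) 1 0; rewrite e10 nonarch_absM -/P.
move=> hc hb hda.
have b0 := nonarch_abs_ge0 (A 0 1); have c0 := nonarch_abs_ge0 (A 1 0).
have da0 := nonarch_abs_ge0 (A 1 1 - A 0 0).
apply: nonarch_absB_le; last by nra.
by apply: nonarch_absD_le; rewrite !nonarch_absM z1 !mulr1; nra.
Qed.

(** * Interpolation at the cube roots of unity *)

(** Distinct cube roots of unity [x], [y] satisfy [x^2 + x y + y^2 = 0];
    comparing two such relations gives the vanishing of the power sums. *)
Lemma cube_roots_of_unity_sums (z0 z1 z2 : K) : uniq [:: z0; z1; z2] ->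
  z0 ^+ 3 = 1 -> z1 ^+ 3 = 1 -> z2 ^+ 3 = 1 ->
  z0 + z1 + z2 = 0 /\ z0 ^+ 2 + z1 ^+ 2 + z2 ^+ 2 = 0.
Proof.
rewrite /= !inE negb_or andbT => /andP[/andP[n01 n02] n12] h0 h1 h2.
have quad (x y : K) : x != y -> x ^+ 3 = 1 -> y ^+ 3 = 1 ->
    x ^+ 2 + x * y + y ^+ 2 = 0.
  rewrite -subr_eq0 => nxy hx hy; apply: (mulfI nxy).
  transitivity (x ^+ 3 - y ^+ 3); first by ring.
  by rewrite hx hy mulr0 subrr.
have q01 := quad _ _ n01 h0 h1; have q02 := quad _ _ n02 h0 h2.
have s1 : z0 + z1 + z2 = 0.
  move: n12; rewrite -subr_eq0 => n12; apply: (mulfI n12).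
  transitivity ((z0 ^+ 2 + z0 * z1 + z1 ^+ 2) - (z0 ^+ 2 + z0 * z2 + z2 ^+ 2)).
    by ring.
  by rewrite q01 q02 mulr0 subrr.
split=> //; have -> : z2 = - (z0 + z1).
  by apply/eqP; rewrite -addr_eq0 addrC s1.
by rewrite -[RHS](mulr0 2) -q01; ring.
Qed.

(** Lagrange interpolation at the cube roots of unity: pairing the values of
    the form with [z], [z^2] and [1] isolates three times each coefficient. *)
Lemma fixed_form_interpolation (A : 'M[K]_2) (z0 z1 z2 : K) :
  uniq [:: z0; z1; z2] -> z0 ^+ 3 = 1 -> z1 ^+ 3 = 1 -> z2 ^+ 3 = 1 ->
  let q := fixed_form A in
  [/\ 3 * A 1 0 = q z0 * z0 + q z1 * z1 + q z2 * z2,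
      3 * (A 1 1 - A 0 0) = q z0 * z0 ^+ 2 + q z1 * z1 ^+ 2 + q z2 * z2 ^+ 2
    & 3 * A 0 1 = - (q z0 + q z1 + q z2)].
Proof.
move=> zuniq h0 h1 h2 /=.
have [s1 s2] := cube_roots_of_unity_sums zuniq h0 h1 h2.
rewrite /fixed_form; set c := A 1 0; set e := A 1 1 - A 0 0; set b := A 0 1.
split.
- transitivity (c * (z0 ^+ 3 + z1 ^+ 3 + z2 ^+ 3)
    + e * (z0 ^+ 2 + z1 ^+ 2 + z2 ^+ 2) - b * (z0 + z1 + z2)); last by ring.
  by rewrite h0 h1 h2 s1 s2; ring.
- transitivity (c * (z0 ^+ 3 * z0 + z1 ^+ 3 * z1 + z2 ^+ 3 * z2)
    + e * (z0 ^+ 3 + z1 ^+ 3 + z2 ^+ 3)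
    - b * (z0 ^+ 2 + z1 ^+ 2 + z2 ^+ 2)); last by ring.
  by rewrite h0 h1 h2 !mul1r s1 s2; ring.
- transitivity (- (c * (z0 ^+ 2 + z1 ^+ 2 + z2 ^+ 2)
    + e * (z0 + z1 + z2) - 3 * b)); last by ring.
  by rewrite s1 s2; ring.
Qed.

Lemma displacement_mx_le (A : 'M[K]_2) (z0 z1 z2 : K) m :
  3^-1 <= v 3 -> \det A = 1 -> uniq [:: z0; z1; z2] ->
  z0 ^+ 3 = 1 -> z1 ^+ 3 = 1 -> z2 ^+ 3 = 1 ->
  (forall z, z \in [:: z0; z1; z2] ->
     chordal v (moebius_mx A (Some z)) (Some z) <= m) ->
  displacement_mx v A <= 3 * m.
Proof.
move=> v3 detA zuniq h0 h1 h2 moves.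
have N0 : 0 < mx_norm2 v A := lt_le_trans ltr01 (mx_norm2_ge1 detA).
set M := m * mx_norm2 v A.
have q_le z n : z ^+ 3 = 1 -> z \in [:: z0; z1; z2] ->
    v (fixed_form A z * z ^+ n) <= M.
  move=> hz /moves; have z1' : v z = 1 := nonarch_abs_root_of_unity hz.
  have zn1 : v (z ^+ n) = 1.
    apply: (@nonarch_abs_root_of_unity 2).
    by rewrite -exprM mulnC exprM hz expr1n.
  have D0 := image_height_gt0 z detA.
  rewrite chordal_moebius_mx // nonarch_absM zn1 mulr1.
  rewrite ler_pdivrMr // => /le_trans; apply.
  have m0 : 0 <= m.
    by apply: (le_trans (chordal_ge0 _ _) (moves z0 _)); rewrite inE eqxx.
  by rewrite ler_wpM2l ?image_height_le.
have in0 : z0 \in [:: z0; z1; z2] by rewrite inE eqxx.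
have in1 : z1 \in [:: z0; z1; z2] by rewrite !inE eqxx orbT.
have in2 : z2 \in [:: z0; z1; z2] by rewrite !inE eqxx !orbT.
have sum_le n : v (fixed_form A z0 * z0 ^+ n + fixed_form A z1 * z1 ^+ n
    + fixed_form A z2 * z2 ^+ n) <= M.
  by do !apply: nonarch_absD_le; apply: q_le.
have [ec ee eb] := fixed_form_interpolation A zuniq h0 h1 h2.
have third x : v (3 * x) <= M -> v x <= 3 * M.
  by rewrite nonarch_absM => ?; have := nonarch_abs_ge0 x; nra.
have hc : v (A 1 0) <= 3 * M by apply: third; rewrite ec; apply: (sum_le 1).
have he : v (A 1 1 - A 0 0) <= 3 * M by apply: third; rewrite ee.
have hb : v (A 0 1) <= 3 * M.
  apply: third; rewrite eb nonarch_absN //.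
  by have := sum_le 0; rewrite !expr0 !mulr1.
have twice x : v x <= 3 * M -> v (2 * x) <= 3 * M.
  by rewrite -{2}[3 * M]mul1r; apply: nonarch_absM_le; apply: nonarch_abs_nat_le1.
rewrite /displacement_mx ler_pdivrMr // -mulrA -/M.
have [e00 e01 e10 e11] := sub_invmx22 detA.
apply: mx_norm2_le; rewrite ?e00 ?e01 ?e10 ?e11 ?twice //.
by rewrite -opprB nonarch_absN.
Qed.

End Nonarchimedean.

(** * Absolute values of integers *)

Lemma padic_abs_nat_ge (R : realType) (p n : nat) : prime p -> (0 < n)%N ->
  (n%:R)^-1 <= padic_abs R p n%:R.
Proof.
move=> p_prime n0; rewrite /padic_abs.
have -> : (n%:R == 0 :> rat) = false by rewrite pnatr_eq0 gtn_eqF.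
have -> : n%:R = (n%:Z)%:~R :> rat by [].
rewrite numq_int denq_int logn1 /= sub0r -exprnN.
rewrite lef_pV2 ?posrE ?exprn_gt0 ?ltr0n ?(prime_gt0 p_prime) //.
by rewrite -natrX ler_nat dvdn_leq // pfactor_dvdnn.
Qed.

Lemma Cp_abs_nat_ge (R : realType) (p : nat) (C : Cp_field R p) (n : nat) :
  prime p -> (0 < n)%N -> (n%:R)^-1 <= Cp_abs C n%:R.
Proof.
move=> p_prime n0; case: (Cp_completion C) => _ absC _ _.
case: (Qp_completion C) => _ absQ _ _.
rewrite -(rmorph_nat (Cp_inj C)) absC -(rmorph_nat (Qpbar_inj C)).
by rewrite Qpbar_abs_ext -(rmorph_nat (Qp_inj C)) absQ padic_abs_nat_ge.
Qed.

Theorem theorem1p6 (R : realType) (p : nat) (p_prime : prime p)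
    (C : Cp_field R p) (g : PSL2 C) (z0 z1 z2 : C)
    (z_distinct : uniq [:: z0; z1; z2])
    (z0_root : z0 ^+ 3 = 1) (z1_root : z1 ^+ 3 = 1) (z2_root : z2 ^+ 3 = 1) :
  2^-1 * max_move (Cp_abs C) g z0 z1 z2 <= displacement (Cp_abs C) g
  /\ displacement (Cp_abs C) g <= 6 * max_move (Cp_abs C) g z0 z1 z2.
Proof.
have v_na : nonarch_abs (Cp_abs C) by case: (Cp_completion C).
have v2 := Cp_abs_nat_ge C p_prime (isT : (0 < 2)%N).
have v3 := Cp_abs_nat_ge C p_prime (isT : (0 < 3)%N).
have detg : \det (Defs.lift g) = 1 := eqP (valP (repr g)).
have abs1 z : z ^+ 3 = 1 -> Cp_abs C z = 1.
  exact: nonarch_abs_root_of_unity.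
rewrite /displacement /max_move /moebius.
have lower z hz := chordal_moebius_mx_le v_na v2 detg (abs1 z hz).
have upper := displacement_mx_le v_na (m := max_move (Cp_abs C) g z0 z1 z2)
  v3 detg z_distinct z0_root z1_root z2_root.
split.
  by rewrite !maxr_pMr ?invr_ge0 // !ge_max !lower.
apply: le_trans (upper _) _.
  by move=> z; rewrite !inE => /or3P[]/eqP->; rewrite /max_move !le_max lexx ?orbT.
rewrite ler_wpM2r ?ler_nat // le_max; apply/orP; right.
exact: chordal_ge0.
Qed.
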